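(* Let $b_1>1$ and $c>0$. The characteristic surface $\mathcal{C}$, the sonic surface $Son$ and the sonic$'$ surface $Son'$ divide $\mathcal{W}-\Pi\cong\mathbb{R}^3$ into twelve regions; that is, $\mathbb{R}^3\setminus(\mathcal{C}\cup Son\cup Son')$ has exactly twelve connected components.
   Context: The wave manifold $\mathcal{W}$ is the three-dimensional manifold of potential shocks $(u,v,u',v',s)$ (blown up along the diagonal) satisfying the Rankine-Hugoniot relation for the flux $f(u,v)=\frac{v^2}{2}+\frac{(b_1+1)u^2}{2}+a_1u+a_2v$, $g(u,v)=uv+a_3u+a_4v$, where $b_1>1$ and $c=a_3-a_2>0$. With the plane $\Pi$ removed, $\mathcal{W}-\Pi$ is identified with $\mathbb{R}^3$ with coordinates $(z,t,Y)$. In these coordinates the three surfaces are as follows. Characteristic surface: $\mathcal{C}=\{Y=0\}$. Sonic surface (critical points of the shock speed along Hugoniot curves): $Son$ is the set of $(z,t,Y)$ with $$-2c\left[(b_1+1)z^5+(b_1+4)z^3+3z\right]t-\left[(b_1+1)z^4+b_1z^2-1\right]Y-2c\left[(b_1-1)z^2+1\right]=0 .$$ Sonic$'$ surface (critical points of the shock speed along Hugoniot$'$ curves): $Son'$ is the set of $(z,t,Y)$ with $$-2c\left[(b_1+1)z^5+(b_1+4)z^3+3z\right]t+\left[(b_1+1)z^4+b_1z^2-1\right]Y-2c\left[(b_1-1)z^2+1\right]=0 .$$ *)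

(* Defs.v *)
From HB Require Import structures.
From mathcomp Require Import all_boot all_order all_algebra.
From mathcomp Require Import all_classical all_reals all_analysis.
Set Implicit Arguments.
Unset Strict Implicit.
Unset Printing Implicit Defensive.
Import Order.TTheory GRing.Theory Num.Theory.
Import numFieldNormedType.Exports.
Local Open Scope classical_set_scope.
Local Open Scope ring_scope.

(* The wave manifold with the plane Pi removed is identified with R^3, whose
   points are the coordinate triples (z, t, Y). *)

Definition characteristic (R : realType) : set (R * R * R) :=
  [set p | let: (z, t, Y) := p in Y = 0].

(* Critical points of the shock speed along Hugoniot curves, for the flux
   parameters b1 and c = a3 - a2. *)
Definition sonic (R : realType) (b1 c : R) : set (R * R * R) :=
  [set p | let: (z, t, Y) := p in
    - 2 * c * ((b1 + 1) * z ^+ 5 + (b1 + 4) * z ^+ 3 + 3 * z) * t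
    - ((b1 + 1) * z ^+ 4 + b1 * z ^+ 2 - 1) * Y
    - 2 * c * ((b1 - 1) * z ^+ 2 + 1) = 0].

(* Critical points of the shock speed along Hugoniot' curves; only the sign of
   the Y term differs from sonic. *)
Definition sonic' (R : realType) (b1 c : R) : set (R * R * R) :=
  [set p | let: (z, t, Y) := p in
    - 2 * c * ((b1 + 1) * z ^+ 5 + (b1 + 4) * z ^+ 3 + 3 * z) * t
    + ((b1 + 1) * z ^+ 4 + b1 * z ^+ 2 - 1) * Y
    - 2 * c * ((b1 - 1) * z ^+ 2 + 1) = 0].

Definition components (T : topologicalType) (A : set T) : set (set T) :=
  connected_component A @` A.

(* Main.v *)
Require Import Defs.
From mathcomp Require Import all_boot all_order all_algebra.
From mathcomp Require Import all_classical all_reals all_analysis.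
From mathcomp Require Import ring lra.
Import Order.TTheory GRing.Theory Num.Theory.
Import numFieldNormedType.Exports.
Local Open Scope classical_set_scope.
Local Open Scope ring_scope.
Local Open Scope card_scope.

(** Write the two sonic equations as [A + Q Y = 0] and [A - Q Y = 0], where
    [A = P(z) t + N(z)].  Here [P] vanishes only at [z = 0], [N] is
    positive, and [Q = ((b1 + 1) z^2 - 1) (z^2 + 1)] has the sign of [|z| - r]
    with [r = 1 / sqrt (b1 + 1)].

    By the symmetry [Y -> - Y], which swaps the two sonic surfaces, consider a
    half space [y = |Y| > 0].  For a fixed [z] the three surfaces are lines in
    the [(t, Y)] plane, hence every choice of signs of [A + Q y] and [A - Q y]
    cuts out a convex set; the question is for which [z] it is nonempty.
    - Both positive: possible for all [z] (take [t = 0] and [y] small).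
      One region.
    - Both negative: this forces [A < 0], impossible on [z = 0] where
      [A = N(0) > 0], and possible as soon as [P(z) <> 0], by the choice of
      [t].  Two regions, one for each sign of [z].
    - [A + Q y > 0 > A - Q y]: this forces [Q > 0], that is [|z| > r], and is
      then possible with [A = 0].  Two regions.
    - [A + Q y < 0 < A - Q y]: this forces [Q < 0], that is [|z| < r], and is
      then possible with [t = 0] and [y] large.  One region.
    This makes six regions in each half space (lemma [bigcup_region]).

    Each region is open (lemma [open_region]) and lies over an interval of
    values of [z] with convex fibres; a continuous section over that interval
    makes it connected (lemmas [connected_convex_fibres], [section_in_region]
    and [section_continuous]).  Pairwise disjoint nonempty open connected sets
    are the components of their union (lemma [components_bigcup]), so there
    are twelve of them. *)

(** * Components of a union of disjoint open connected sets *)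

(** A connected set cannot meet two pieces, because each piece is also closed
    in the union, its complement there being a union of open pieces. *)
Lemma components_bigcup (T : topologicalType) (I : Type) (F : I -> set T) :
  (forall i, open (F i)) -> (forall i, connected (F i)) ->
  (forall i, F i !=set0) -> trivIset setT F ->
  components (\bigcup_i F i) = range F.
Proof.
move=> oF cF F0 tF; set U := \bigcup_i F i.
have compF i x : F i x -> connected_component U x = F i.
  move=> Fix; apply/seteqP; split; last first.
    by apply: connected_component_max => //; exact: bigcup_sup.
  move=> y [C [Cx CU cC] Cy].
  suff CFC : C `&` F i = C by move: Cy; rewrite -CFC => -[].
  apply: cC; first by exists x.
    by exists (F i) => //; exact: oF.
  exists (~` \bigcup_(j in [set j | j <> i]) F j).
    by apply: open_closedC; apply: bigcup_open => j _; exact: oF.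
  apply/seteqP; split => z [Cz Fz]; split => //.
    move=> [j ji Fjz]; apply: ji.
    by apply: (tF j i) => //; exists z.
  have [j _ Fjz] := CU _ Cz.
  have [<- //|ji] := pselect (j = i).
  by exfalso; apply: Fz; exists j.
apply/seteqP; split => [_ [x [i _ Fix] <-]|_ [i _ <-]].
  by exists i => //; rewrite (compF i).
have [x Fix] := F0 i.
by exists x; [exists i|exact: compF].
Qed.

Lemma card_components_bigcup {T : topologicalType} {I : finType}
    {F : I -> set T} :
  (forall i, open (F i)) -> (forall i, connected (F i)) ->
  (forall i, F i !=set0) -> trivIset setT F ->
  components (\bigcup_i F i) #= `I_#|I|.
Proof.
move=> oF cF F0 tF; rewrite components_bigcup//.
have injF : {in [set: I] &, injective F}.
  by apply: trivIset_inj => // i _; exact: F0.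
apply: card_eq_trans (inj_card_eq injF) _.
rewrite card_eq_sym; apply: card_eq_trans card_II _; rewrite card_eq_sym.
have <- : range (@enum_rank I) = setT.
  by apply/seteqP; split => // k _; exists (enum_val k) => //; exact: enum_valK.
by rewrite card_eq_sym; apply: inj_card_eq => i j _ _; exact: enum_rank_inj.
Qed.

(** * Sets with convex fibres over an interval *)

Lemma continuous_pair {S T U : topologicalType} {f : S -> T} {g : S -> U}
    {x : S} :
  {for x, continuous f} -> {for x, continuous g} ->
  {for x, continuous (fun x => (f x, g x))}.
Proof. by move=> cf cg; apply: (cvg_pair cf cg). Qed.

(** Every point is joined to the graph of the section, which is connected,
    by the segment inside its own fibre. *)
Lemma connected_convex_fibres {R : realType} {U : set (R * R * R)} {I : set R}
    {st sY : R -> R} :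
  is_interval I ->
  (forall z, I z -> {for z, continuous st}) ->
  (forall z, I z -> {for z, continuous sY}) ->
  (forall z, I z -> U (z, st z, sY z)) ->
  (forall z t Y, U (z, t, Y) -> I z) ->
  (forall z t Y t' Y' l, U (z, t, Y) -> U (z, t', Y') -> 0 <= l <= 1 ->
     U (z, t + l * (t' - t), Y + l * (Y' - Y))) ->
  connected U.
Proof.
move=> itvI ct cY sU UI convU.
pose s z := (z, st z, sY z).
pose seg (p : R * R * R) (l : R) :=
  (p.1.1, p.1.2 + l * (st p.1.1 - p.1.2), p.2 + l * (sY p.1.1 - p.2)).
pose S p := s @` I `|` seg p @` `[0, 1].
have cseg p : continuous (seg p).
  move=> l; rewrite /seg.
  apply: (@continuous_pair _ _ _ (fun l => (_, _)) (fun l => _));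
    first apply: (@continuous_pair _ _ _ (fun l => _) (fun l => _)).
  - exact: cvg_cst.
  - apply: cvgD; first exact: cvg_cst.
    by apply: cvgM; [exact: cvg_id|exact: cvg_cst].
  - apply: cvgD; first exact: cvg_cst.
    by apply: cvgM; [exact: cvg_id|exact: cvg_cst].
have csI : connected (s @` I).
  apply: connected_continuous_connected; first exact/connected_intervalP.
  rewrite continuous_subspace_in => z /set_mem Iz.
  apply: continuous_subspaceT_for => //.
  by apply: continuous_pair;
    [apply: continuous_pair; [exact: cvg_id|exact: ct]|exact: cY].
have cS p : U p -> connected (S p).
  move: p => [[z t] Y] Up; refine (connectedU _ csI _).
    exists (s z); split; first by exists z => //; exact: UI Up.
    exists 1; first by rewrite /= in_itv/= ler01 lexx.
    by rewrite /seg /s /= !mul1r !subrKC.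
  apply: connected_continuous_connected.
    by apply/connected_intervalP; exact: interval_is_interval.
  exact: continuous_subspaceT.
have [[[[z0 t0] Y0] U0]|U0] := pselect (U !=set0); last first.
  have -> : U = set0 by apply/eqP/negPn/negP => /set0P.
  exact: connected0.
have -> : U = \bigcup_(p in U) S p.
  apply/seteqP; split => [[[z t] Y] Up|p [[[z t] Y] Up [[z' Iz' <-]|[l l01 <-]]]].
  - exists (z, t, Y) => //; right; exists 0.
      by rewrite /= in_itv/= ler01 lexx.
    by rewrite /seg /= !mul0r !addr0.
  - exact: sU.
  - by apply: convU => //=; exact/sU/(UI _ _ _ Up).
apply: bigcup_connected => //; exists (s z0) => p Up.
by left; exists z0 => //; exact: UI U0.
Qed.

(** * The twelve regions *)

Section Regions.
Context {R : realType} (P Q N : R -> R) (r : R).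
Hypotheses (cP : continuous P) (cQ : continuous Q) (cN : continuous N).
Hypotheses (P_eq0 : forall z, (P z == 0) = (z == 0)).
Hypotheses (sgQ : forall z, Num.sg (Q z) = Num.sg (`|z| - r)).
Hypotheses (r0 : 0 < r) (N0 : forall z, 0 < N z).

Let index : finType := (bool * bool * option bool)%type.

(** The interval of values of [z] met by a region.  The flag [same] says
    whether [A + Q y] and [A - Q y] have the same sign; [Some b] selects one of
    two mirror images, on the side [z > 0] for [b = false] and [z < 0] for
    [b = true] (so that [(-1) ^+ b] is the sign of [z]), and [None] the region
    symmetric in [z]. *)
Definition zrange (same : bool) (o : option bool) : interval R :=
  let rho := if same then 0 else r in
  match o with
  | Some false => `]rho, +oo[
  | Some true => `]-oo, - rho[
  | None => if same then `]-oo, +oo[ else `]- r, r[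
  end.

(** The boolean [e] gives the sign of [Y] as [(-1) ^+ e], so that [y p] is
    [|Y|].  In the exponents the coercion from [option] to [bool] sends [None]
    to [false] and [Some _] to [true]: the sign of [A - Q y] is positive exactly
    for the regions symmetric in [z], both when the signs agree and when they
    differ. *)
Definition region (i : index) : set (R * R * R) :=
  let: (e, same, o) := i in
  let y p := (-1) ^+ e * p.2 in
  let A p := P p.1.1 * p.1.2 + N p.1.1 in
  [set p | [/\ p.1.1 \in zrange same o, 0 < y p,
    0 < (-1) ^+ (o (+) ~~ same) * (A p + Q p.1.1 * y p) &
    0 < (-1) ^+ o * (A p - Q p.1.1 * y p)]].

Lemma open_region i : open (region i).
Proof.
move: i => [[e same] o].
have pos (f : R * R * R -> R) : continuous f -> open [set p | 0 < f p].
  move=> cf; have -> : [set p | 0 < f p] = f @^-1` `]0, +oo[.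
    by apply/seteqP; split => p /=; rewrite in_itv/= andbT.
  by apply: open_comp; [move=> p _; exact: cf|exact: interval_open].
have cz : continuous (fun p : R * R * R => p.1.1).
  by move=> p; apply: continuous_comp; exact: cvg_fst.
have ct : continuous (fun p : R * R * R => p.1.2).
  by move=> p; apply: continuous_comp; [exact: cvg_fst|exact: cvg_snd].
have cy : continuous (fun p : R * R * R => (-1) ^+ e * p.2).
  by move=> p; apply: cvgM; [exact: cvg_cst|exact: cvg_snd].
have comp1 f : continuous f -> continuous (fun p : R * R * R => f p.1.1).
  by move=> cf p; exact: (cvg_comp _ _ (cz p) (cf _)).
have cA : continuous (fun p : R * R * R => P p.1.1 * p.1.2 + N p.1.1).
  by move=> p; apply: cvgD;
    [apply: cvgM; [exact: comp1|exact: ct]|exact: comp1].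
have cQy : continuous (fun p : R * R * R => Q p.1.1 * ((-1) ^+ e * p.2)).
  by move=> p; apply: cvgM; [exact: comp1|exact: cy].
have -> : region (e, same, o) =
    ((fun p => p.1.1) @^-1` [set` zrange same o] `&`
     [set p | 0 < (-1) ^+ e * p.2]) `&`
    ([set p | 0 < (-1) ^+ (o (+) ~~ same) *
       (P p.1.1 * p.1.2 + N p.1.1 + Q p.1.1 * ((-1) ^+ e * p.2))] `&`
     [set p | 0 < (-1) ^+ o *
       (P p.1.1 * p.1.2 + N p.1.1 - Q p.1.1 * ((-1) ^+ e * p.2))]).
  by apply/seteqP; split => p /= => [[]|[[? ?] [? ?]]].
apply: openI; apply: openI; try apply: pos => //.
- apply: open_comp; first by move=> p _; exact: cz.
  by case: o => [[]|]; case: same; apply: interval_open.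
- move=> p; apply: cvgM; first exact: cvg_cst.
  by apply: cvgD; [exact: cA|exact: cQy].
- move=> p; apply: cvgM; first exact: cvg_cst.
  by apply: cvgB; [exact: cA|exact: cQy].
Qed.

Lemma Q_gt0 z : (0 < Q z) = (r < `|z|).
Proof. by rewrite -sgr_gt0 sgQ sgr_gt0 subr_gt0. Qed.

Lemma Q_lt0 z : (Q z < 0) = (`|z| < r).
Proof. by rewrite -sgr_lt0 sgQ sgr_lt0 subr_lt0. Qed.

(** A point of each fibre depending continuously on [z].  With [same], either
    [t = 0] and [y = N / (Q^2 + 1)], so that [|Q| y < N = A], or [y = 1] and
    [A = - (Q^2 + 1) < - |Q|]; otherwise, either [t = 0] and [- Q y = 2 N > A],
    or [y = 1] and [A = 0]. *)
Definition section_t (same : bool) (o : option bool) (z : R) : R :=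
  if o is None then 0
  else if same then - (N z + Q z ^+ 2 + 1) / P z else - N z / P z.

Definition section_y (same : bool) (o : option bool) (z : R) : R :=
  if o is None then if same then N z / (Q z ^+ 2 + 1) else - (2 * N z) / Q z
  else 1.

(** Makes the divisions by [P] in [section_t] legitimate, and [A = 0] a good
    choice when the signs differ. *)
Lemma zrange_Some same b z : z \in zrange same (Some b) ->
  P z != 0 /\ (~~ same -> 0 < Q z).
Proof.
rewrite P_eq0 Q_gt0 /zrange => h; split.
  by move: h; case: b; case: same; rewrite in_itv/= ?andbT => h;
   apply/eqP; move: r0; lra.
by case: same b h => // -[]; rewrite in_itv/= ?andbT => h _; rewrite ltr_normr; lra.
Qed.

Lemma section_in_region e same o z : z \in zrange same o ->
  region (e, same, o) (z, section_t same o z, (-1) ^+ e * section_y same o z).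
Proof.
move=> hz; rewrite /region /=; rewrite signrMK.
have Nz := N0 z.
case: o hz => [b|] hz /=.
  have [Pz Qz] := zrange_Some _ _ _ hz.
  split=> //; rewrite /section_t/section_y.
  - case: same Qz hz => /= Qz hz; rewrite [P z * _]mulrC divfK//.
    + nra.
    + have := Qz isT; lra.
  - case: same Qz hz => /= Qz hz; rewrite [P z * _]mulrC divfK//.
    + nra.
    + have := Qz isT; lra.
rewrite /section_t /section_y mulr0 add0r mul1r.
case: same hz => /= hz.
  have Qz : 0 < Q z ^+ 2 + 1 by nra.
  have y0 : 0 < N z / (Q z ^+ 2 + 1) by rewrite divr_gt0.
  have NE : N z = (Q z ^+ 2 + 1) * (N z / (Q z ^+ 2 + 1)).
    by rewrite mulrC divfK// gt_eqF.
  split=> //; set y := N z / _ in y0 NE *; rewrite NE.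
    by rewrite mul1r -mulrDl mulr_gt0//; nra.
  by rewrite -mulrBl mulr_gt0//; nra.
have Qz : Q z < 0 by rewrite Q_lt0 ltr_norml; move: hz; rewrite in_itv.
split=> //; first by rewrite nmulr_lgt0 ?invr_lt0//; lra.
- by rewrite [Q z * _]mulrC divfK ?lt_eqF//; lra.
- by rewrite [Q z * _]mulrC divfK ?lt_eqF//; lra.
Qed.

Lemma section_continuous same o z : z \in zrange same o ->
  {for z, continuous (section_t same o)} /\
  {for z, continuous (section_y same o)}.
Proof.
have cst (k : R) : {for z, continuous (fun=> k)} by exact: cvg_cst.
have cQ2 : {for z, continuous (fun z => Q z ^+ 2 + 1)}.
  exact: cvgD (cvgM (cQ z) (cQ z)) (cst 1).
case: o => [b|] hz.
  have [Pz _] := zrange_Some _ _ _ hz; split; last exact: cst.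
  rewrite /section_t; case: same hz => hz;
    apply: cvgM; try (by apply: cvgV => //; exact: cP).
    apply: cvgN; apply: cvgD; last exact: cst.
    by apply: cvgD; [exact: cN|exact: cvgM (cQ z) (cQ z)].
  by apply: cvgN; exact: cN.
split; first exact: cst.
rewrite /section_y; case: same hz => hz; apply: cvgM; try exact: cN.
- by apply: cvgV => //; rewrite gt_eqF//; nra.
- by apply: cvgN; apply: cvgM; [exact: cst|exact: cN].
- apply: cvgV; last exact: cQ.
  by rewrite lt_eqF// Q_lt0 ltr_norml; move: hz; rewrite in_itv.
Qed.

Lemma connected_region i : connected (region i).
Proof.
move: i => [[e same] o].
apply: (@connected_convex_fibres _ _ [set` zrange same o] (section_t same o)
          (fun z => (-1) ^+ e * section_y same o z)).
- exact: interval_is_interval.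
- by move=> z /section_continuous[].
- move=> z /section_continuous[_ cy].
  by apply: cvgM => //; exact: cvg_cst.
- by move=> z; exact: section_in_region.
- by move=> z t Y [].
- move=> z t Y t' Y' l [/= hz h1 h2 h3] [/= _ h1' h2' h3'] /andP[l0 l1].
  have comb (a b : R) : 0 < a -> 0 < b -> 0 < a + l * (b - a) by nra.
  split => //=.
  + by have := comb _ _ h1 h1'; congr (0 < _); ring.
  + by have := comb _ _ h2 h2'; congr (0 < _); ring.
  + by have := comb _ _ h3 h3'; congr (0 < _); ring.
Qed.

Lemma region_nonempty i : region i !=set0.
Proof.
move: i => [[e same] o].
suff [z hz] : exists z, z \in zrange same o.
  exists (z, section_t same o z, (-1) ^+ e * section_y same o z).
  exact: section_in_region.
case: o => [[]|]; case: same.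
- by exists (-1); rewrite in_itv/=; lra.
- by exists (- r - 1); rewrite in_itv/=; lra.
- by exists 1; rewrite in_itv/=; lra.
- by exists (r + 1); rewrite in_itv/=; lra.
- by exists 0; rewrite in_itv.
- by exists 0; rewrite in_itv/=; move: r0; lra.
Qed.

Lemma region_disjoint : trivIset setT region.
Proof.
move=> [[e s] o] [[e' s'] o'] _ _ [[[z t] Y]].
move=> [[/= hz h1 h2 h3] [/= hz' h1' h2' h3']].
have sgn_inj (b b' : bool) (x : R) :
    0 < (-1) ^+ b * x -> 0 < (-1) ^+ b' * x -> b = b'.
  by case: b; case: b' => //; rewrite ?expr0 ?expr1; lra.
have ee := sgn_inj _ _ _ h1 h1'; rewrite -ee in h1' h2' h3' *.
have oo := sgn_inj _ _ _ h3 h3'.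
have := sgn_inj _ _ _ h2 h2'; rewrite oo => /addbI /negb_inj ss.
rewrite -ss in hz' *.
suff -> : o = o' by [].
case: o o' oo hz hz' {h1 h2 h3 h1' h2' h3'} => [b|] [b'|] //= _.
by case: b b' s {ss} => [] [] [] // hz hz'; exfalso;
  move: hz hz'; rewrite !in_itv/=; move: r0; lra.
Qed.

(** Each sign pattern of the three nonvanishing forms confines [z] to the
    intervals that [zrange] assigns to it: two opposite signs of [A + Q y] and
    [A - Q y] determine the sign of [Q], and two negative ones make [A]
    negative. *)
Lemma bigcup_region : \bigcup_i region i =
  [set p | [/\ p.2 != 0, P p.1.1 * p.1.2 + N p.1.1 + Q p.1.1 * p.2 != 0 &
               P p.1.1 * p.1.2 + N p.1.1 - Q p.1.1 * p.2 != 0]].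
Proof.
have neq0 (b : bool) (x : R) : 0 < (-1) ^+ b * x -> x != 0.
  by apply: contraTneq => ->; rewrite mulr0 ltxx.
have gt0 (x : R) : x != 0 -> 0 < (-1) ^+ (x < 0)%R * x.
  by rewrite -normrEsign normr_gt0.
apply/seteqP; split => [[[z t] Y] [[[e s] o] _ [/= _ h1 h2 h3]]|
                        [[z t] Y] [/= Y0 h1 h2]].
  have [Y0 h2' h3'] := And3 (neq0 _ _ h1) (neq0 _ _ h2) (neq0 _ _ h3).
  by case: e h2' h3' {h1 h2 h3} => /=;
    rewrite ?expr0 ?expr1 ?mul1r// ?mulN1r mulrN ?opprK.
set A := P z * t + N z in h1 h2.
set e := Y < 0.
have y0 : 0 < (-1) ^+ e * Y by exact: gt0.
set y := (-1) ^+ e * Y in y0.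
have h1y : A + Q z * y != 0.
  by rewrite /y; case: (e); rewrite ?expr0 ?expr1 ?mul1r// mulN1r mulrN.
have h2y : A - Q z * y != 0.
  by rewrite /y; case: (e); rewrite ?expr0 ?expr1 ?mul1r// mulN1r mulrN opprK.
have reg same o : z \in zrange same o ->
    (A + Q z * y < 0) = (o (+) ~~ same) -> (A - Q z * y < 0) = o ->
    (\bigcup_i region i) (z, t, Y).
  move=> hz ha hb; exists (e, same, o) => //; split => //=.
  - by rewrite -/A -/y -ha gt0.
  - by rewrite -/A -/y -hb gt0.
have Nz := N0 z.
have [Qgt Qlt] := (Q_gt0 z, Q_lt0 z).
move: h1y h2y; rewrite !neq_lt => /orP[a1|a1] /orP[a2|a2].
- have [z0|z0|z0] := ltgtP z 0.
  + by apply: (reg true (Some true)); rewrite ?in_itv/= ?oppr0 ?a1 ?a2.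
  + by apply: (reg true (Some false)); rewrite ?in_itv/= ?z0 ?a1 ?a2.
  + (* On the plane z = 0 the form A is N, hence positive. *)
    have P0 : P z = 0 by apply/eqP; rewrite P_eq0 z0.
    by exfalso; move: a1 a2; rewrite /A P0; lra.
- have Qn : Q z < 0 by nra.
  apply: (reg false None).
  + by rewrite in_itv/= -ltr_norml -Qlt.
  + by rewrite a1.
  + by rewrite /= ltNge ltW.
- have Qp : 0 < Q z by nra.
  move: Qp; rewrite Qgt ltr_normr => /orP[zr|zr].
  + apply: (reg false (Some false)); rewrite ?in_itv/= ?zr ?a2//.
    by rewrite ltNge ltW.
  + apply: (reg false (Some true)); rewrite ?in_itv/= ?a2//; first by rewrite ltrNr.
    by rewrite ltNge ltW.
- apply: (reg true None) => //=.
  + by rewrite ltNge ltW.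
  + by rewrite ltNge ltW.
Qed.

(** The twelve is [2 * 2 * 3]: the sign of [Y], whether the two sonic forms
    agree in sign, and the three values of [option bool]. *)
Lemma twelve_components :
  components [set p : R * R * R | [/\ p.2 != 0,
      P p.1.1 * p.1.2 + N p.1.1 + Q p.1.1 * p.2 != 0 &
      P p.1.1 * p.1.2 + N p.1.1 - Q p.1.1 * p.2 != 0]] #= `I_12.
Proof.
rewrite -bigcup_region.
have -> : 12%N = #|index| by rewrite !card_prod card_option !card_bool.
apply: card_components_bigcup.
- exact: open_region.
- exact: connected_region.
- exact: region_nonempty.
- exact: region_disjoint.
Qed.

End Regions.

(** * The sonic surfaces *)

Theorem proposition1 (R : realType) (b1 c : R) (hb1 : 1 < b1) (hc : 0 < c) :
  components (~` (@characteristic R `|` sonic b1 c `|` sonic' b1 c)) #= `I_12.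
Proof.
pose P (z : R) := 2 * c * ((b1 + 1) * z ^+ 5 + (b1 + 4) * z ^+ 3 + 3 * z).
pose Q (z : R) := (b1 + 1) * z ^+ 4 + b1 * z ^+ 2 - 1.
pose N (z : R) := 2 * c * ((b1 - 1) * z ^+ 2 + 1).
pose r := (Num.sqrt (b1 + 1))^-1.
have r0 : 0 < r by rewrite invr_gt0 sqrtr_gt0; lra.
have rE : (b1 + 1) * r ^+ 2 = 1.
  by rewrite exprVn sqr_sqrtr ?divff//; [apply/eqP|]; lra.
have -> : ~` (@characteristic R `|` sonic b1 c `|` sonic' b1 c) =
  [set p | [/\ p.2 != 0, P p.1.1 * p.1.2 + N p.1.1 + Q p.1.1 * p.2 != 0 &
               P p.1.1 * p.1.2 + N p.1.1 - Q p.1.1 * p.2 != 0]].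
  rewrite !setCU; apply/seteqP.
  split => [[[z t] Y] [[/= /eqP h1 h2] h3]|[[z t] Y] [/= /eqP h1 /eqP h2 /eqP h3]].
    by split=> //=; apply/eqP => h; [apply: h2|apply: h3];
      rewrite -[RHS]oppr0 -h /P /Q /N; ring.
  by split; first split; move=> //= h; [apply: h2|apply: h3];
    rewrite -[RHS]oppr0 -h /P /Q /N; ring.
pose pE := (hornerD, hornerN, hornerM, hornerC, hornerXn, hornerX).
apply: (@twelve_components R P Q N r) => //.
- have -> : P = horner ((2 * c)%:P *
      ((b1 + 1)%:P * 'X^5 + (b1 + 4)%:P * 'X^3 + 3%:P * 'X)).
    by apply/funext => z; rewrite !pE.
  exact: continuous_horner.
- have -> : Q = horner ((b1 + 1)%:P * 'X^4 + b1%:P * 'X^2 - 1%:P).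
    by apply/funext => z; rewrite !pE.
  exact: continuous_horner.
- have -> : N = horner ((2 * c)%:P * ((b1 - 1)%:P * 'X^2 + 1%:P)).
    by apply/funext => z; rewrite !pE.
  exact: continuous_horner.
- move=> z.
  have -> : P z = 2 * c * ((b1 + 1) * z ^+ 4 + (b1 + 4) * z ^+ 2 + 3) * z.
    by rewrite /P; ring.
  by rewrite mulf_eq0 gt_eqF//= mulr_gt0 ?mulr_gt0//; nra.
- move=> z.
  have -> : Q z = (z ^+ 2 + 1) * (b1 + 1) * (`|z| + r) * (`|z| - r).
    transitivity ((z ^+ 2 + 1) * ((b1 + 1) * `|z| ^+ 2 - (b1 + 1) * r ^+ 2));
      last by ring.
    by rewrite real_normK ?num_real// rE /Q; ring.
  rewrite sgrM gtr0_sg ?mul1r// mulr_gt0 ?mulr_gt0//; first nra.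
    lra.
  by rewrite ltr_wpDl.
- by move=> z; rewrite /N mulr_gt0 ?mulr_gt0//; nra.
Qed.
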